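(* For a (possibly unbounded) positive self-adjoint operator $A$ in a Hilbert space $H$ the following conditions are equivalent: (i) $A$ is the unique positive closed densely defined operator $T$ in $H$ such that $|T|=A$; (ii) $A$ is bounded.
   Context: Hilbert spaces are complex. A densely defined linear operator $T\colon\mathcal D(T)\to H$ with $\mathcal D(T)\subset H$ is positive if $\langle Tx,x\rangle_H\ge0$ for every $x\in\mathcal D(T)$; positive operators need not be self-adjoint. For a closed densely defined operator $T$, its absolute value $|T|$ is the unique positive self-adjoint operator with $|T|^2=T^*T$ (and $\mathcal D(|T|)=\mathcal D(T)$). *)

(* Defs.v *)
From HB Require Import structures.
From mathcomp Require Import all_boot all_order all_algebra complex.
From mathcomp Require Import all_classical all_reals all_analysis.

Set Implicit Arguments.
Unset Strict Implicit.
Unset Printing Implicit Defensive.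

Import Order.TTheory GRing.Theory Num.Theory Num.Def.
Import numFieldNormedType.Exports.

Local Open Scope classical_set_scope.
Local Open Scope ring_scope.
Local Open Scope complex_scope.

(* Complex Hilbert spaces. The scalars are [R[i]]; as in sesquilinear.v, the
   inner product is linear in its first argument and conjugate-linear in its
   second one. *)
HB.mixin Record CompleteNormedModule_isHilbert (R : realType) H
    of CompleteNormedModule R[i] H := {
  inner : {dot H for (@conjC R[i])};
  inner_norm : forall x : H, inner x x = `|x| ^+ 2
}.

#[short(type="hilbertType")]
HB.structure Definition Hilbert (R : realType) :=
  { H of CompleteNormedModule R[i] H & CompleteNormedModule_isHilbert R H }.

(* A partially defined map [H -> H]; the values of [app] outside [dom] carry no
   meaning, so operators are compared with [op_eq], not with Leibniz
   equality. *)
Record operator (H : Type) := Operator { dom : set H; app :> H -> H }.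

Section Operators.
Context {R : realType} {H : hilbertType R}.
Implicit Types (S T A P : operator H) (x y z : H).

Definition op_eq S T : Prop :=
  dom S = dom T /\ (forall x, dom S x -> S x = T x).

Definition linear_op T : Prop :=
  dom T 0 /\
  forall (a : R[i]) x y, dom T x -> dom T y ->
    dom T (a *: x + y) /\ T (a *: x + y) = a *: T x + T y.

Definition densely_defined T : Prop := dense (dom T).

Definition op_graph T : set (H * H) := [set p | dom T p.1 /\ p.2 = T p.1].

Definition closed_op T : Prop := closed (op_graph T).

(* Order on [R[i]]: [0 <= w] means that [w] is real and nonnegative. *)
Definition positive_op T : Prop := forall x, dom T x -> 0 <= inner (T x) x.

Definition bounded_op T : Prop :=
  exists M : R, forall x, dom T x -> `|T x| <= M%:C * `|x|.

Definition comp_op S T : operator H :=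
  Operator [set x | dom T x /\ dom S (T x)] (fun x => S (T x)).

Definition adjoint_val T y : set H :=
  [set z | forall x, dom T x -> inner (T x) y = inner x z].

(* When [T] is densely defined, [adjoint_val T y] has at most one element. *)
Definition adjoint T : operator H :=
  Operator [set y | adjoint_val T y !=set0] (fun y => xget 0 (adjoint_val T y)).

Definition selfadjoint T : Prop := densely_defined T /\ op_eq T (adjoint T).

(* [P] is the absolute value of [T], i.e. [P = |T|]; equality of the compositions
   includes equality of their domains. *)
Definition is_abs T P : Prop :=
  [/\ linear_op P, selfadjoint P, positive_op P &
      op_eq (comp_op P P) (comp_op (adjoint T) T)].

Definition positive_closed_with_abs A T : Prop :=
  [/\ linear_op T, densely_defined T, closed_op T, positive_op T & is_abs T A].

End Operators.

(* Main.v *)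
From HB Require Import structures.
Require Import Defs.
From mathcomp Require Import all_boot all_order all_algebra complex.
From mathcomp Require Import all_classical all_reals all_analysis.
From mathcomp Require Import ring lra.

Set Implicit Arguments.
Unset Strict Implicit.
Unset Printing Implicit Defensive.

Import Order.TTheory GRing.Theory Num.Theory Num.Def.
Import numFieldNormedType.Exports.

Local Open Scope classical_set_scope.
Local Open Scope ring_scope.
Local Open Scope complex_scope.

(** Bounded case. A bounded self-adjoint [A] is defined everywhere, and so is any
   [T] with [|T| = A]. A positive operator on a complex Hilbert space is
   symmetric, so [T^* T = A ^+ 2] becomes [T ^+ 2 = A ^+ 2], and [T = A] since
   bounded positive operators have unique positive square roots
   ([positive_sqrt_unique]).

   Unbounded case. A symmetric operator defined everywhere is bounded
   ([symmetric_map_bounded]), so some vector [e] lies outside the domain of [A].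
   Extend [A] to [C] by [C e = 0]; as the graph of [A] is closed and [e] spans a
   line, [C] is closed ([extension_by_zero]), and it has a modulus [|C|], positive
   and with [| |C| x | = |C x|] ([modulus_exists]). Let [T] be the restriction of
   [|C|] to the domain of [A]. Then [T] is positive and [|T x| = |A x|], which
   makes [T] closed and yields [T^* T = A ^+ 2] by polarization. If [T] were [A],
   the symmetry of [|C|] and [|C| e = 0] would give [<A x, e> = 0] for all [x], so
   [e] would belong to the domain of [A^* = A] ([abs_not_uniq]).

   The modulus is obtained from bounded operators only. With
   [Q = (1 + C^* C)^-1], which the projection theorem on the graph of [C]
   provides, and [N] the positive square root of [Q - Q ^+ 2], the modulus maps
   [Q w] to [N w] and is extended by closure. Its norm is right because
   [|N w| ^+ 2 = <Q w, w> - |Q w| ^+ 2 = |C (Q w)| ^+ 2]. Square roots come from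
   the iteration [Y (n+1) = (X + (Y n) ^+ 2) / 2] ([sqrt_exists]).

   Most computations use the real part [ip] of the inner product and the real
   number [nm x] underlying the norm, so that they take place in [R]. *)

(** * The real part of the inner product *)

Section RealInnerProduct.
Context {R : realType} {H : hilbertType R}.
Implicit Types (x y z : H) (a : R[i]) (r : R).

Definition ip x y : R := complex.Re (inner x y).
Definition nm x : R := complex.Re `|x|.

Lemma normE x : `|x| = (nm x)%:C.
Proof. by rewrite /nm RRe_real // ger0_real. Qed.

Lemma nm_ge0 x : 0 <= nm x.
Proof. by rewrite -ler0c -normE normr_ge0. Qed.

Lemma nmN x : nm (- x) = nm x. Proof. by rewrite /nm normrN. Qed.

Lemma nm0 : nm (0 : H) = 0. Proof. by rewrite /nm normr0. Qed.

Lemma nmZ r x : nm (r%:C *: x) = `|r| * nm x.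
Proof.
by apply: complexI; rewrite rmorphM /= -normE normrZ normE normc_def /= expr0n
  /= addr0 sqrtr_sqr.
Qed.

Lemma normc_Re a : (complex.Re `|a|)%:C = `|a|.
Proof. by rewrite RRe_real // ger0_real. Qed.

Lemma normc_Re_ge0 a : 0 <= complex.Re `|a|.
Proof. by rewrite -ler0c normc_Re. Qed.

Lemma nm_scale a x : nm (a *: x) = complex.Re `|a| * nm x.
Proof.
by apply: complexI; rewrite rmorphM /= -normE normrZ normE; congr (_ * _);
  rewrite [RHS]normc_Re.
Qed.

Lemma nm_distC x y : nm (x - y) = nm (y - x).
Proof. by rewrite -nmN opprB. Qed.

Lemma nmD x y : nm (x + y) <= nm x + nm y.
Proof. by rewrite -lecR rmorphD /= -!normE ler_normD. Qed.

Lemma nmB x y : nm (x - y) <= nm x + nm y.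
Proof. by rewrite -(nmN y) nmD. Qed.

Lemma nm_eq0 x : nm x = 0 -> x = 0.
Proof. by move=> h; apply/eqP; rewrite -normr_eq0 normE h. Qed.

Lemma innerDl x y z : inner (x + y) z = inner x z + inner y z.
Proof. exact: linearDl. Qed.

Lemma innerNl x z : inner (- x) z = - inner x z.
Proof. exact: linearNl. Qed.

Lemma innerZl a x z : inner (a *: x) z = a * inner x z.
Proof. exact: linearZl_LR. Qed.

Lemma innerZr a x z : inner x (a *: z) = a^*%C * inner x z.
Proof. exact: linearZr_LR. Qed.

Lemma ipDl x y z : ip (x + y) z = ip x z + ip y z.
Proof. by rewrite /ip innerDl; case: (inner x z) (inner y z) => ? ? [? ?]. Qed.

Lemma ipNl x z : ip (- x) z = - ip x z.
Proof. by rewrite /ip innerNl; case: (inner x z). Qed.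

Lemma ipBl x y z : ip (x - y) z = ip x z - ip y z.
Proof. by rewrite ipDl ipNl. Qed.

Lemma innerC x y : inner x y = (inner y x)^*%C.
Proof. by rewrite hermC expr0 mul1r. Qed.

Lemma ipC x y : ip x y = ip y x.
Proof. by rewrite /ip innerC; case: (inner y x). Qed.

Lemma ipDr x y z : ip z (x + y) = ip z x + ip z y.
Proof. by rewrite ipC ipDl !(ipC _ z). Qed.

Lemma ipNr x z : ip z (- x) = - ip z x.
Proof. by rewrite ipC ipNl ipC. Qed.

Lemma ipBr x y z : ip z (x - y) = ip z x - ip z y.
Proof. by rewrite ipDr ipNr. Qed.

Lemma ip0l x : ip 0 x = 0.
Proof. by rewrite -(subrr 0) ipBl subrr. Qed.

Lemma ip0r x : ip x 0 = 0. Proof. by rewrite ipC ip0l. Qed.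

Lemma ipJ a x y : ip (a *: x) y = ip x (a^*%C *: y).
Proof. by rewrite /ip innerZl innerZr /= conjcK. Qed.

Lemma ipZl r x y : ip (r%:C *: x) y = r * ip x y.
Proof.
by rewrite /ip innerZl; case: (inner x y) => c d /=; rewrite mul0r subr0.
Qed.

Lemma ipZr r x y : ip x (r%:C *: y) = r * ip x y.
Proof. by rewrite ipC ipZl ipC. Qed.

Lemma ip_nm x : ip x x = nm x ^+ 2.
Proof. by rewrite /ip inner_norm normE -rmorphXn. Qed.

Lemma innerE x y : inner x y = (ip x y +i* ip x ('i%C *: y))%C.
Proof.
rewrite /ip innerZr; case: (inner x y) => c d /=.
by rewrite mul0r sub0r mulN1r opprK.
Qed.

Lemma cauchy_schwarz x y : ip x y <= nm x * nm y.
Proof.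
have [x0|x0] := eqVneq (nm x) 0; first by rewrite (nm_eq0 x0) ip0l nm0 mul0r.
have [y0|y0] := eqVneq (nm y) 0; first by rewrite (nm_eq0 y0) ip0r nm0 mulr0.
have h : 0 < nm x * nm y by rewrite mulr_gt0 // lt0r nm_ge0 ?x0 ?y0.
have : 0 <= ip ((nm y)%:C *: x - (nm x)%:C *: y) ((nm y)%:C *: x - (nm x)%:C *: y).
  by rewrite ip_nm sqr_ge0.
rewrite !(ipBl, ipBr, ipZl, ipZr) !ip_nm (ipC y x) => {x0 y0} le0.
have : 0 <= (nm x * nm y) * (nm x * nm y - ip x y) by lra.
by rewrite pmulr_rge0 // subr_ge0.
Qed.

(** A polynomial [t * s + t ^+ 2 * w] without constant term that never becomes
   negative has no linear term either; this turns extremality into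
   orthogonality. *)
Lemma quadratic_ge0_linear0 (s w : R) :
  0 <= w -> (forall t, 0 <= t * s + t ^+ 2 * w) -> s = 0.
Proof.
move=> w0 /(_ (- s / (w + 1))) h.
have w1 : 0 < w + 1 by lra.
have i0 : 0 < (w + 1)^-1 by rewrite invr_gt0.
have wi : (w + 1) * (w + 1)^-1 = 1 by rewrite divff // gt_eqF.
move: h; set i := (w + 1)^-1 in i0 wi *.
have iw : i * w = 1 - i by rewrite -wi; ring.
have -> : - s * i * s + (- s * i) ^+ 2 * w = s ^+ 2 * i * (i * w - 1) by ring.
have -> : s ^+ 2 * i * (i * w - 1) = - (s * i) ^+ 2 by rewrite iw; ring.
rewrite oppr_ge0 real_exprn_even_le0 ?num_real //= mulf_eq0 (gt_eqF i0) orbF.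
by move/eqP.
Qed.

Lemma ip_norm_le x y : `|ip x y| <= nm x * nm y.
Proof.
by rewrite ler_norml lerNl -ipNl -(nmN x) cauchy_schwarz nmN cauchy_schwarz.
Qed.

(** The imaginary part of [<x, y>] is, up to sign, the real part of
   [<'i x, y>], so real parts suffice once [x] may be rescaled. *)
Lemma inner_eq x y u v :
  (forall a, ip (a *: x) y = ip (a *: u) v) -> inner x y = inner u v.
Proof.
move=> h; rewrite !innerE -[x]scale1r -[u]scale1r h.
by rewrite scale1r -(conjcK 'i) -!ipJ h scale1r.
Qed.

Lemma ip_ext x y : (forall z, ip x z = ip y z) -> x = y.
Proof.
move=> h; apply/eqP; rewrite -subr_eq0; apply/eqP/nm_eq0.
by apply/eqP; rewrite -sqrf_eq0 -ip_nm ipBl h subrr.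
Qed.

(** * Limits of sequences of vectors *)

Lemma cvg_nmP (u : nat -> H) x :
  u @ \oo --> x <-> (fun n => nm (u n - x)) @ \oo --> (0 : R).
Proof.
split=> [/cvgrPdist_lt h|/cvgrPdist_lt h]; apply/cvgrPdist_lt => e e0.
  have := h e%:C; rewrite ltcR => /(_ e0); apply: filterS => n.
  by rewrite normE ltcR sub0r normrN ger0_norm ?nm_ge0// nm_distC.
have eE : e = (complex.Re e)%:C by rewrite RRe_real // gtr0_real.
have := h (complex.Re e); rewrite -ltcR -eE => /(_ e0); apply: filterS => n.
by rewrite sub0r normrN ger0_norm ?nm_ge0 // normE eE ltcR nm_distC.
Qed.

Lemma cvg_nm_le (u : nat -> H) x (d : nat -> R) :
  (forall n, nm (u n - x) <= d n) -> d @ \oo --> (0 : R) -> u @ \oo --> x.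
Proof.
move=> h d0; apply/cvg_nmP; apply: squeeze_cvgr (cvg_cst 0) d0.
by near=> n; rewrite nm_ge0 h.
Unshelve. all: by end_near. Qed.

Lemma cvg_nm (u : nat -> H) x :
  u @ \oo --> x -> (fun n => nm (u n)) @ \oo --> nm x.
Proof.
move=> /cvg_nmP h; apply/cvgrPdist_lt => e e0.
move/cvgrPdist_lt: h => /(_ e e0); apply: filterS => n.
rewrite sub0r normrN ger0_norm ?nm_ge0 // => h.
apply: le_lt_trans h; rewrite ler_norml; apply/andP; split.
  by have := nmD (u n - x) x; rewrite subrK; lra.
by have := nmD (x - u n) (u n); rewrite subrK nm_distC; lra.
Qed.

Lemma cvg_ip (u v : nat -> H) x y : u @ \oo --> x -> v @ \oo --> y ->
  (fun n => ip (u n) (v n)) @ \oo --> ip x y.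
Proof.
have polar z t : ip z t = (nm (z + t) ^+ 2 - nm (z - t) ^+ 2) / 4.
  rewrite -!ip_nm !(ipDl, ipDr, ipNl, ipNr) (ipC t z); lra.
move=> hu hv; rewrite polar.
rewrite (_ : (fun n => _) = (fun n => (nm (u n + v n) ^+ 2 - nm (u n - v n) ^+ 2) / 4)).
  apply: cvgMl; apply: cvgB; under eq_fun do rewrite expr2; rewrite expr2.
    by apply: cvgM; apply: cvg_nm; apply: cvgD.
  by apply: cvgM; apply: cvg_nm; apply: cvgB.
by apply/funext => n; rewrite polar.
Qed.

Lemma cvg_lim_eq (u : nat -> H) x y :
  u @ \oo --> x -> u @ \oo --> y -> x = y.
Proof. by move=> hx hy; apply: (cvg_unique _ hx hy). Qed.

Lemma cvg_of_cauchy (u : nat -> H) :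
  (forall e : R, 0 < e -> exists N, forall m n, (N <= m)%N -> (N <= n)%N ->
     nm (u m - u n) < e) -> exists x, u @ \oo --> x.
Proof.
move=> h; suff /cauchy_cvg cu : cauchy (u @ \oo).
  by exists (lim (u @ \oo)).
apply/cauchy_exP => e e0.
have eE : e = (complex.Re e)%:C by rewrite RRe_real // gtr0_real.
have := h (complex.Re e); rewrite -ltcR -eE => /(_ e0)[N hN].
exists (u N); exists N => // n /= Nn.
by rewrite -ball_normE /ball_ /= normE eE ltcR hN.
Qed.

Lemma cvg_cauchy_nm (u : nat -> H) x : u @ \oo --> x ->
  forall e : R, 0 < e -> exists N, forall m n, (N <= m)%N -> (N <= n)%N ->
     nm (u m - u n) < e.
Proof.
move=> /cvg_nmP/cvgrPdist_lt h e e0.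
have /h[N _ hN] : 0 < e / 2 by rewrite divr_gt0.
exists N => m n /hN /= hm /hN /=; move: hm.
rewrite !sub0r !normrN !ger0_norm ?nm_ge0 // => hm hn.
have := nmB (u m - x) (u n - x); rewrite opprB addrA subrK; lra.
Qed.

Lemma cvg_dominated (u v : nat -> H) x : v @ \oo --> x ->
  (forall m n, nm (u m - u n) <= nm (v m - v n)) -> exists y, u @ \oo --> y.
Proof.
move=> /cvg_cauchy_nm h uv; apply: cvg_of_cauchy => e /h[N hN].
by exists N => m n Nm Nn; apply: le_lt_trans (uv _ _) _; apply: hN.
Qed.

End RealInnerProduct.

(** * Square roots of bounded positive operators *)

Section SquareRoot.
Context {R : realType} {H : hilbertType R}.
Implicit Types (x y z : H) (f g X P Q N : H -> H).

Definition symmetric_map f := forall x y, ip (f x) y = ip x (f y).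
Definition positive_map f := forall x, 0 <= ip (f x) x.

Section LinearMap.
Variables (f : H -> H) (f_lin : linear f).

Let lf : {linear H -> H} := HB.pack f (GRing.isLinear.Build _ _ _ _ f f_lin).

Lemma linear_map0 : f 0 = 0. Proof. exact: (linear0 lf). Qed.
Lemma linear_mapD x y : f (x + y) = f x + f y.
Proof. exact: (linearD lf). Qed.
Lemma linear_mapB x y : f (x - y) = f x - f y.
Proof. exact: (linearB lf). Qed.
Lemma linear_mapZ (a : R[i]) x : f (a *: x) = a *: f x.
Proof. by rewrite -[a *: x]addr0 f_lin linear_map0 addr0. Qed.

End LinearMap.

Fixpoint sqrt_iter X n : H -> H :=
  if n is m.+1 then
    fun z => (2^-1 : R)%:C *: (X z + sqrt_iter X m (sqrt_iter X m z))
  else fun=> 0.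

Fixpoint sqrt_bound n : R :=
  if n is m.+1 then 2^-1 * (1 + sqrt_bound m ^+ 2) else 0.

Lemma sqrt_bound_itv n : 0 <= sqrt_bound n <= 1.
Proof.
elim: n => [|n /andP[h0 h1]] /=; first by rewrite lexx ler01.
have : 0 <= sqrt_bound n ^+ 2 <= 1 by rewrite sqr_ge0 expr_le1.
by case/andP => ? ?; apply/andP; split; lra.
Qed.

Lemma sqrt_bound_cvg : exists l : R, sqrt_bound @ \oo --> l.
Proof.
have h : nondecreasing_seq sqrt_bound.
  apply/nondecreasing_seqP => n /=; case/andP: (sqrt_bound_itv n) => h0 h1.
  have := sqr_ge0 (1 - sqrt_bound n); rewrite sqrrB expr1n mul1r; lra.
exists (limn sqrt_bound); apply: nondecreasing_is_cvgn h _.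
by exists 1 => _ [n _ <-]; case/andP: (sqrt_bound_itv n).
Qed.

Section Iteration.
Variables (X : H -> H) (X_lin : linear X) (X_sym : symmetric_map X).
Hypothesis X_le : forall x, nm (X x) <= nm x.

Local Notation Y := (sqrt_iter X).

Lemma sqrt_iter_linear n : linear (Y n).
Proof.
elim: n => [|n IH] a x y /=; first by rewrite scaler0 addr0.
rewrite !IH X_lin !scalerDr !scalerA !(mulrC a) -!addrA; congr (_ + _).
by rewrite addrCA.
Qed.

Lemma sqrt_iter_sym n : symmetric_map (Y n).
Proof.
elim: n => [|n IH] x y /=; first by rewrite ip0l ip0r.
by rewrite ipZl ipZr ipDl ipDr X_sym !IH.
Qed.

Lemma sqrt_iter_le n z : nm (Y n z) <= sqrt_bound n * nm z.
Proof.
elim: n z => [|n IH] z /=; first by rewrite nm0 mul0r.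
rewrite nmZ ger0_norm ?invr_ge0 //; case/andP: (sqrt_bound_itv n) => h0 h1.
rewrite -mulrA ler_pM2l ?invr_gt0 // mulrDl mul1r.
apply: le_trans (nmD _ _) _; apply: lerD => //.
by apply: le_trans (IH _) _; rewrite expr2 -mulrA ler_wpM2l.
Qed.

(** The scalar recursion [sqrt_bound] is the operator one at [X = 1]; since
   [Y ^+ 2 - Z ^+ 2 = Y (Y - Z) + (Y - Z) Z], it dominates the increments of the
   operator recursion. *)
Lemma sqrt_iter_incr n z :
  nm (Y n.+1 z - Y n z) <= (sqrt_bound n.+1 - sqrt_bound n) * nm z.
Proof.
elim: n z => [|n IH] z.
  rewrite /= !subr0 addr0 expr0n /= addr0 mulr1 nmZ ger0_norm ?invr_ge0 //.
  by rewrite ler_pM2l ?invr_gt0.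
have -> : Y n.+2 z - Y n.+1 z = (2^-1 : R)%:C *:
    (Y n.+1 (Y n.+1 z - Y n z) + (Y n.+1 (Y n z) - Y n (Y n z))).
  rewrite [Y n.+2 z]/= -/(Y n.+1 z) -/(Y n.+1 (Y n.+1 z)) [in X in _ - X]/=.
  rewrite -scalerBr (linear_mapB (sqrt_iter_linear n.+1)) addrA subrK.
  by congr (_ *: _); rewrite opprD addrACA subrr add0r.
rewrite nmZ ger0_norm ?invr_ge0 //.
have -> : sqrt_bound n.+2 - sqrt_bound n.+1 = 2^-1 *
    (sqrt_bound n.+1 * (sqrt_bound n.+1 - sqrt_bound n)
     + (sqrt_bound n.+1 - sqrt_bound n) * sqrt_bound n).
  rewrite [sqrt_bound n.+2]/= -/(sqrt_bound n.+1) [in X in _ - X]/=; ring.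
case/andP: (sqrt_bound_itv n.+1) => h0 _.
have hd : 0 <= sqrt_bound n.+1 - sqrt_bound n.
  by have := sqr_ge0 (1 - sqrt_bound n); rewrite sqrrB expr1n mul1r /=; lra.
rewrite -mulrA ler_pM2l ?invr_gt0 // mulrDl.
apply: le_trans (nmD _ _) _; apply: lerD.
  by apply: le_trans (sqrt_iter_le _ _) _; rewrite -mulrA ler_wpM2l.
by apply: le_trans (IH _) _; rewrite -mulrA ler_wpM2l // sqrt_iter_le.
Qed.

Lemma sqrt_iter_dist m n z : (m <= n)%N ->
  nm (Y n z - Y m z) <= (sqrt_bound n - sqrt_bound m) * nm z.
Proof.
move/subnK <-; elim: (n - m)%N => [|k IH]; first by rewrite !subrr nm0 mul0r.
rewrite addSn.
have -> : Y (k + m).+1 z - Y m z =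
  (Y (k + m).+1 z - Y (k + m) z) + (Y (k + m) z - Y m z) by rewrite addrA subrK.
apply: le_trans (nmD _ _) _.
have := sqrt_iter_incr (k + m) z; lra.
Qed.

Lemma sqrt_iter_cvg z : exists y, (fun n => Y n z) @ \oo --> y.
Proof.
have [l /cvgrPdist_lt hl] := sqrt_bound_cvg.
apply: cvg_of_cauchy => e e0.
have c0 : 0 < nm z + 1 by rewrite ltr_wpDl ?nm_ge0.
have /hl[N _ hN] : 0 < e / (nm z + 1) / 2 by rewrite !divr_gt0.
exists N => m n Nm Nn.
wlog mn : m n Nm Nn / (m <= n)%N.
  move=> h; case/orP: (leq_total m n) => ?; first exact: h.
  by rewrite nm_distC; apply: h.
rewrite nm_distC; apply: le_lt_trans (sqrt_iter_dist z mn) _.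
have := hN m Nm; have := hN n Nn; rewrite /= => hn hm.
have : sqrt_bound n - sqrt_bound m <= e / (nm z + 1).
  rewrite (splitr (e / _)).
  have := ler_norm (l - sqrt_bound m); rewrite distrC in hn.
  have := ler_norm (sqrt_bound n - l); lra.
move/(ler_wpM2r (nm_ge0 z))/le_lt_trans; apply.
by rewrite mulrAC ltr_pdivrMr // ltr_pM2l // ltrDl.
Qed.

(** The increasing sequence [Y (n+1) = (X + (Y n) ^+ 2) / 2] converges to a
   solution of [Y = (X + Y ^+ 2) / 2], that is [(1 - Y) ^+ 2 = 1 - X]. *)
Lemma sqrt_exists : exists N : H -> H,
  [/\ linear N, symmetric_map N, positive_map N,
      forall x, N (N x) = x - X x &
      forall Z c, linear Z -> (forall x, nm (Z x) <= c * nm x) ->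
        (forall x, Z (X x) = X (Z x)) -> forall x, Z (N x) = N (Z x)].
Proof.
have [L hL] := choice sqrt_iter_cvg.
have L_lin : linear L.
  move=> a x y; apply: cvg_lim_eq (hL _) _.
  rewrite (_ : (fun n => _) = (fun n => a *: Y n x + Y n y)).
    by apply: cvgD; [apply: cvgZr|].
  by apply/funext => n; rewrite sqrt_iter_linear.
have L_sym : symmetric_map L.
  move=> x y.
  have hl : (fun n => ip (Y n x) y) @ \oo --> ip (L x) y.
    by apply: cvg_ip (hL x) _; apply: cvg_cst.
  have hr : (fun n => ip (Y n x) y) @ \oo --> ip x (L y).
    under eq_fun do rewrite sqrt_iter_sym.
    by apply: cvg_ip (hL y); apply: cvg_cst.
  exact: (cvg_unique _ hl hr).
have Y_le n z : nm (Y n z) <= nm z.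
  apply: le_trans (sqrt_iter_le _ _) _; case/andP: (sqrt_bound_itv n) => _ h1.
  by rewrite -[leRHS]mul1r ler_wpM2r ?nm_ge0.
have L_le z : nm (L z) <= nm z.
  by apply: cvgr_to_le (cvg_nm (hL z)) _; near=> n; rewrite Y_le.
have LL_cvg z : (fun n => Y n (Y n z)) @ \oo --> L (L z).
  apply: (@cvg_nm_le _ _ _ _ (fun n => nm (Y n z - L z) + nm (Y n (L z) - L (L z)))).
    move=> n; have -> : Y n (Y n z) - L (L z) =
        Y n (Y n z - L z) + (Y n (L z) - L (L z)).
      by rewrite (linear_mapB (sqrt_iter_linear n)) addrA subrK.
    by apply: le_trans (nmD _ _) _; rewrite lerD2r Y_le.
  by rewrite -[0]addr0; apply: cvgD; apply/cvg_nmP.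
have L_fix z : L z = (2^-1 : R)%:C *: (X z + L (L z)).
  apply: (cvg_lim_eq (u := fun n => Y n.+1 z)).
    by have := hL z; rewrite -cvg_shiftS.
  by apply: cvgZr; apply: cvgD; [apply: cvg_cst|].
exists (fun x => x - L x); split.
- move=> a x y /=; rewrite L_lin scalerBr opprD !addrA; congr (_ - _).
  by rewrite addrAC.
- by move=> x y /=; rewrite ipBl ipBr L_sym.
- move=> x; rewrite ipBl subr_ge0; apply: le_trans (cauchy_schwarz _ _) _.
  by rewrite ip_nm expr2 ler_wpM2r ?nm_ge0.
- move=> x /=; rewrite (linear_mapB L_lin).
  have -> : X x = L x + L x - L (L x).
    apply/eqP; rewrite eq_sym subr_eq; apply/eqP.
    rewrite {1 2}L_fix -scalerDl -rmorphD /= (_ : 2^-1 + 2^-1 = 1) ?scale1r //.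
    by lra.
  by rewrite -addrA -opprD addrA.
- move=> Z c Z_lin Z_le ZX x; rewrite (linear_mapB Z_lin); congr (_ - _).
  have ZY n y : Z (Y n y) = Y n (Z y).
    elim: n y => [|n IH] y /=; first exact: linear_map0.
    by rewrite (linear_mapZ Z_lin) (linear_mapD Z_lin) ZX !IH.
  apply: (cvg_lim_eq (u := fun n => Y n (Z x))); last exact: hL.
  apply: (@cvg_nm_le _ _ _ _ (fun n => c * nm (Y n x - L x))).
    by move=> n; rewrite -ZY -(linear_mapB Z_lin).
  by rewrite -(mulr0 c); apply: cvgMr; apply/cvg_nmP.
Unshelve. all: by end_near. Qed.

End Iteration.

(** Let [D = P - N]. As [P] and [N] commute, [(P + N) D = 0], so the nonnegative
   numbers [<P D x, D x>] and [<N D x, D x>] add up to zero. *)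
Lemma commuting_sqrt_eq P N : linear P -> linear N ->
  symmetric_map P -> symmetric_map N -> positive_map P -> positive_map N ->
  (forall x, P (N x) = N (P x)) -> (forall x, P (P x) = N (N x)) ->
  forall x, P x = N x.
Proof.
have vanish Q : linear Q -> symmetric_map Q -> positive_map Q ->
    forall x, ip (Q x) x = 0 -> Q x = 0.
  move=> Ql Qs Qp x Qx0.
  have /eqP : 2 * nm (Q x) ^+ 2 = 0.
    apply: (quadratic_ge0_linear0 (Qp (Q x))) => t.
    have := Qp (t%:C *: Q x + x).
    rewrite Ql !(ipDl, ipDr, ipZl, ipZr) Qx0 (Qs (Q x) x) -!ip_nm; lra.
  by rewrite mulf_eq0 pnatr_eq0 /= sqrf_eq0 => /eqP/nm_eq0.
move=> Pl Nl Ps Ns Pp Np PN PPNN x.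
pose d := P x - N x.
have PNd : P d + N d = 0.
  by rewrite /d (linear_mapB Pl) (linear_mapB Nl) PPNN PN addrA subrK subrr.
have PNd0 : ip (P d) d + ip (N d) d = 0 by rewrite -ipDl PNd ip0l.
have Pd0 : P d = 0 by apply: vanish => //; have := Pp d; have := Np d; lra.
have Nd0 : N d = 0 by apply: vanish => //; have := Pp d; have := Np d; lra.
apply/eqP; rewrite -subr_eq0 -/d; apply/eqP/nm_eq0/eqP.
by rewrite -sqrf_eq0 -ip_nm {2}/d ipBr -Ps -Ns Pd0 Nd0 !ip0l subrr.
Qed.

(** After division by [c], the map [1 - P ^+ 2] is a contraction; the square root
   given by [sqrt_exists] commutes with every root of [P ^+ 2], so that both [P]
   and [Q] are equal to it. *)
Lemma positive_sqrt_unique P Q (c : R) : 0 < c ->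
  (forall x, nm (P x) <= c * nm x) -> linear P -> linear Q ->
  symmetric_map P -> symmetric_map Q -> positive_map P -> positive_map Q ->
  (forall x, P (P x) = Q (Q x)) -> forall x, P x = Q x.
Proof.
move=> c0 Pc Pl Ql Ps Qs Pp Qp PQ.
pose k : R := c^-1 ^+ 2.
have k0 : 0 < k by rewrite exprn_gt0 // invr_gt0.
pose X x := x - k%:C *: P (P x).
have X_lin : linear X.
  move=> a x y; rewrite /X !Pl scalerBr scalerDr !scalerA (mulrC a) opprD !addrA.
  by congr (_ - _); rewrite addrAC.
have X_sym : symmetric_map X.
  by move=> x y; rewrite /X ipBl ipBr ipZl ipZr !Ps.
have X_le x : nm (X x) <= nm x.
  rewrite -(ler_pXn2r (n := 2)) ?nnegrE ?nm_ge0 // -!ip_nm /X.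
  rewrite !(ipBl, ipBr, ipZl, ipZr) -(Ps x) (Ps (P x) x) !ip_nm.
  have : nm (P (P x)) ^+ 2 <= (c * nm (P x)) ^+ 2.
    by rewrite ler_pXn2r ?nnegrE ?nm_ge0 ?mulr_ge0 ?nm_ge0 // ltW.
  rewrite exprMn => h.
  have : k * nm (P (P x)) ^+ 2 <= nm (P x) ^+ 2.
    rewrite /k exprVn mulrC ler_pdivrMr ?exprn_gt0 // mulrC //.
  move/(ler_wpM2l (ltW k0)) => h'.
  have := mulr_ge0 (ltW k0) (sqr_ge0 (nm (P x))); lra.
have [N [Nl Ns Np NN NZ]] := sqrt_exists X_lin X_sym X_le.
pose M x := c%:C *: N x.
have M_lin : linear M by move=> a x y; rewrite /M Nl scalerDr !scalerA (mulrC a).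
have M_sym : symmetric_map M by move=> x y; rewrite /M ipZl ipZr Ns.
have M_pos : positive_map M by move=> x; rewrite /M ipZl mulr_ge0 // ltW.
have MM x : M (M x) = P (P x).
  rewrite /M (linear_mapZ Nl) NN /X opprB addrC subrK !scalerA -!rmorphM /k.
  by rewrite expr2 !mulrA mulfK ?divff ?scale1r // gt_eqF.
have Qc x : nm (Q x) <= c * nm x.
  rewrite -(ler_pXn2r (n := 2)) ?nnegrE ?nm_ge0 ?mulr_ge0 ?nm_ge0 ?(ltW c0) //.
  rewrite -ip_nm Qs -PQ -Ps ip_nm ler_pXn2r ?nnegrE ?nm_ge0 ?mulr_ge0 ?nm_ge0 //.
  exact: ltW.
have eqM S : linear S -> symmetric_map S -> positive_map S ->
    (forall x, nm (S x) <= c * nm x) -> (forall x, S (S x) = P (P x)) ->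
    forall x, S x = M x.
  move=> Sl Ss Sp Sc SP; apply: commuting_sqrt_eq => // x; last by rewrite MM.
  rewrite /M (linear_mapZ Sl) (NZ S c) // => y.
  by rewrite /X (linear_mapB Sl) (linear_mapZ Sl) -!SP.
by move=> x; rewrite (eqM P) // (eqM Q).
Qed.

End SquareRoot.

(** * Unbounded operators *)

Section Operators.
Context {R : realType} {H : hilbertType R}.
Implicit Types (S T A C : operator H) (x y z w : H) (a : R[i]).

Section LinearOperator.
Variables (T : operator H) (T_lin : linear_op T).

Lemma op_dom0 : dom T 0. Proof. by case: T_lin. Qed.

Lemma op_domP a x y : dom T x -> dom T y -> dom T (a *: x + y).
Proof. by case: T_lin => _ h hx hy; case: (h a x y hx hy). Qed.

Lemma opP a x y : dom T x -> dom T y -> T (a *: x + y) = a *: T x + T y.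
Proof. by case: T_lin => _ h hx hy; case: (h a x y hx hy). Qed.

Lemma op0 : T 0 = 0.
Proof.
have := opP (-1) op_dom0 op_dom0.
by rewrite scaleN1r oppr0 addr0 scaleN1r addNr.
Qed.

Lemma op_domZ a x : dom T x -> dom T (a *: x).
Proof. by move=> h; rewrite -[_ *: _]addr0; apply: op_domP => //; exact: op_dom0. Qed.

Lemma opZ a x : dom T x -> T (a *: x) = a *: T x.
Proof.
by move=> h; rewrite -[a *: x]addr0 opP ?op0 ?addr0 //; exact: op_dom0.
Qed.

Lemma op_domB x y : dom T x -> dom T y -> dom T (x - y).
Proof.
by move=> hx hy; rewrite addrC -scaleN1r; apply: op_domP.
Qed.

Lemma opB x y : dom T x -> dom T y -> T (x - y) = T x - T y.
Proof.
by move=> hx hy; rewrite addrC -scaleN1r opP // scaleN1r addrC.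
Qed.

Lemma op_domD x y : dom T x -> dom T y -> dom T (x + y).
Proof. by move=> hx hy; rewrite -[x]scale1r; apply: op_domP. Qed.

Lemma opD x y : dom T x -> dom T y -> T (x + y) = T x + T y.
Proof. by move=> hx hy; rewrite -[x]scale1r opP // !scale1r. Qed.

End LinearOperator.

Lemma inner_ge0P x y : 0 <= inner x y <-> 0 <= ip x y /\ ip x ('i%C *: y) = 0.
Proof.
rewrite innerE lecE /=; split; first by case/andP => /eqP -> ->.
by case=> -> ->; rewrite eqxx.
Qed.

(** Over the complex scalars positivity entails symmetry, by polarization. *)
Lemma positive_op_sym T : linear_op T -> positive_op T ->
  forall x y, dom T x -> dom T y -> ip (T x) y = ip x (T y).
Proof.
move=> Tl Tp.
have im0 x : dom T x -> ip (T x) ('i%C *: x) = 0.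
  by move=> /Tp/inner_ge0P[].
have im x y : dom T x -> dom T y -> ip (T x) ('i%C *: y) = - ip (T y) ('i%C *: x).
  move=> hx hy; have := im0 _ (op_domD Tl hx hy).
  rewrite (opD Tl) // scalerDr ipDl !ipDr !im0 //; lra.
move=> x y hx hy.
have := im _ _ hx (op_domZ Tl 'i%C hy).
rewrite (opZ Tl) // ipJ !scalerA.
have -> : ('i * 'i)%C = -1 :> R[i] by rewrite -expr2 sqr_i.
have -> : (('i)^* * 'i)%C = 1 :> R[i] by apply/eqP; rewrite eq_complex /=; apply/andP; split; apply/eqP; ring.
by rewrite scaleN1r scale1r ipNr => /oppr_inj ->; rewrite ipC.
Qed.

(** * Closed graphs and sequences *)

Lemma closed_op_lim T (u : nat -> H) x y : closed_op T ->
  (forall n, dom T (u n)) -> u @ \oo --> x -> (T \o u) @ \oo --> y ->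
  dom T x /\ T x = y.
Proof.
move=> Tc hu ux Tuy.
have : op_graph T (x, y).
  have h : (fun n => (u n, T (u n))) @ \oo --> (x, y) by apply: cvg_pair.
  apply: closed_cvg Tc _ _ h; near=> n; split => //=.
by case=> /= ? ->.
Unshelve. all: by end_near. Qed.

Lemma harmonic_nm_cvg (u : nat -> H) x :
  (forall n, nm (u n - x) <= n.+1%:R^-1) -> u @ \oo --> x.
Proof. by move=> h; apply: cvg_nm_le h _; apply: cvg_harmonic. Qed.

Lemma ball_nm x y (e : R) : ball x e%:C y -> nm (y - x) < e.
Proof. by rewrite -ball_normE /ball_ /= normE ltcR nm_distC. Qed.

Lemma closed_op_of_lim T :
  (forall (u : nat -> H) x y, (forall n, dom T (u n)) -> u @ \oo --> x ->
     (T \o u) @ \oo --> y -> dom T x /\ T x = y) -> closed_op T.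
Proof.
move=> h [x y] cl.
have e0 n : (0 : R[i]) < (n.+1%:R^-1 : R)%:C by rewrite ltcR invr_gt0 ltr0n.
have /choice[u hu] : forall n, exists w, [/\ dom T w,
    nm (w - x) <= n.+1%:R^-1 & nm (T w - y) <= n.+1%:R^-1].
  move=> n; have [[w v] [[/= dw ->] [/=]]] := cl _ (nbhsx_ballx (x, y) _ (e0 n)).
  by move=> /ball_nm/ltW hw /ball_nm/ltW hv; exists w; split.
have [||| dx Tx] := h u x y.
- by move=> n; case: (hu n).
- by apply: harmonic_nm_cvg => n; case: (hu n).
- by apply: harmonic_nm_cvg => n; case: (hu n).
- by split.
Qed.

Lemma dense_approx (D : set H) x (e : R) : dense D -> 0 < e ->
  exists2 y, D y & nm (y - x) < e.
Proof.
move=> Dd e0.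
have /(_ _ _)[||y [By Dy]] := Dd (ball x e%:C).
- by exists x; apply: ballxx; rewrite ltcR.
- by apply: ball_open; rewrite ltcR.
by exists y => //; apply: ball_nm.
Qed.

(** * Orthogonal projection in [H * H] *)

(** The nearest point of [K] is the limit of a minimizing sequence, which is
   Cauchy by the parallelogram identity. *)
Lemma projection (K : H -> H -> Prop) p0 q0 :
  K 0 0 ->
  (forall a x y x' y', K x y -> K x' y' -> K (a *: x + x') (a *: y + y')) ->
  (forall (u v : nat -> H) x y, (forall n, K (u n) (v n)) ->
     u @ \oo --> x -> v @ \oo --> y -> K x y) ->
  exists p q, K p q /\
    forall x y, K x y -> ip (p0 - p) x + ip (q0 - q) y = 0.
Proof.
move=> K0 KP Kcl.
pose d p q : R := nm (p0 - p) ^+ 2 + nm (q0 - q) ^+ 2.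
pose E : set R := [set t | exists p q, K p q /\ t = d p q].
have Elb : lbound E 0.
  by move=> _ [p [q [_ ->]]]; rewrite addr_ge0 // sqr_ge0.
have Einf : has_inf E by split; [exists (d 0 0), 0, 0 | exists 0].
have dmin p q : K p q -> inf E <= d p q.
  by move=> Kpq; apply: ge_inf; [exists 0 | exists p, q].
have e0 n : (0 : R) < n.+1%:R^-1 by rewrite invr_gt0.
have /choice[f hf] : forall n, exists pq : H * H,
    K pq.1 pq.2 /\ d pq.1 pq.2 < inf E + n.+1%:R^-1.
  move=> n; have [_ [p [q [Kpq ->]]] lt] := inf_adherent (e0 n) Einf.
  by exists (p, q).
pose p n := (f n).1; pose q n := (f n).2.
have mid m n : nm (p m - p n) ^+ 2 + nm (q m - q n) ^+ 2 <=
    2 * (m.+1%:R^-1 + n.+1%:R^-1).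
  have [Km dm] := hf m; have [Kn dn] := hf n.
  pose h : R[i] := (2^-1 : R)%:C.
  have Khalf x y : K x y -> K (h *: x) (h *: y).
    by move=> Kxy; rewrite -[h *: x]addr0 -[h *: y]addr0; apply: KP.
  have := dmin _ _ (KP h _ _ _ _ Km (Khalf _ _ Kn)).
  rewrite -/(p m) -/(p n) -/(q m) -/(q n) in dm dn *.
  have par (x0 x y : H) : nm (x0 - (h *: x + h *: y)) ^+ 2 =
      (nm (x0 - x) ^+ 2 + nm (x0 - y) ^+ 2) / 2 - nm (x - y) ^+ 2 / 4.
    rewrite -!ip_nm /h !(ipBl, ipBr, ipDl, ipDr, ipZl, ipZr).
    rewrite (ipC x x0) (ipC y x0) (ipC y x); lra.
  move: dm dn; rewrite /d !par.
  move: (m.+1%:R^-1) (n.+1%:R^-1) => em en; lra.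
have cauchy_of (g : nat -> H) :
    (forall m n, nm (g m - g n) ^+ 2 <= 2 * (m.+1%:R^-1 + n.+1%:R^-1)) ->
    exists x, g @ \oo --> x.
  move=> hg; apply: cvg_of_cauchy => e e_gt0.
  have : 0 < e ^+ 2 / 8 by rewrite divr_gt0 // exprn_gt0.
  have /cvgrPdist_lt hh := @cvg_harmonic R.
  move=> /hh[N _ hN]; exists N => m n /hN /= hm /hN /=; move: hm.
  rewrite !sub0r !normrN !ger0_norm ?invr_ge0 // => hm hn.
  rewrite -(ltr_pXn2r (n := 2)) ?nnegrE ?nm_ge0 ?(ltW e_gt0) //.
  apply: le_lt_trans (hg m n) _; have := exprn_gt0 2 e_gt0.
  move: hm hn; move: (m.+1%:R^-1) (n.+1%:R^-1) => em en; lra.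
have [x px] : exists x, p @ \oo --> x.
  apply: cauchy_of => m n; apply: le_trans (mid m n).
  by rewrite lerDl sqr_ge0.
have [y qy] : exists y, q @ \oo --> y.
  apply: cauchy_of => m n; apply: le_trans (mid m n).
  by rewrite lerDr sqr_ge0.
have Kxy : K x y by apply: Kcl px qy => n; case: (hf n).
have dxy : d x y <= inf E.
  have lim1 : (fun n => d (p n) (q n)) @ \oo --> d x y.
    rewrite /d; under eq_fun do rewrite !expr2; rewrite !expr2.
    by apply: cvgD; apply: cvgM; apply: cvg_nm; apply: cvgB => //; apply: cvg_cst.
  have lim2 : (fun n => inf E + n.+1%:R^-1) @ \oo --> inf E.
    rewrite -[X in _ --> X]addr0; apply: cvgD; first exact: cvg_cst.
    exact: cvg_harmonic.
  apply: ler_cvg_to lim1 lim2 _; near=> n.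
  by apply: ltW; case: (hf n).
exists x, y; split => // x' y' Kxy'.
suff : - 2 * (ip (p0 - x) x' + ip (q0 - y) y') = 0 by lra.
apply: (@quadratic_ge0_linear0 _ _ (nm x' ^+ 2 + nm y' ^+ 2)).
  by rewrite addr_ge0 // sqr_ge0.
move=> t; have := le_trans dxy (dmin _ _ (KP t%:C _ _ _ _ Kxy' Kxy)).
rewrite /d -!ip_nm !(ipBl, ipBr, ipDl, ipDr, ipZl, ipZr).
rewrite !(ipC x' _) !(ipC y' _) (ipC x p0) (ipC y q0); lra.
Unshelve. all: by end_near. Qed.

End Operators.

(** * The modulus of a closed operator *)

Section Modulus.
Context {R : realType} {H : hilbertType R}.
Variables (C : operator H) (C_lin : linear_op C) (C_closed : closed_op C).
Implicit Types (x y z w : H) (a : R[i]).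

(** For densely defined [C], the map [Q] is [(1 + C^* C)^-1]; it is described
   without the adjoint of [C], through the form [<x, u> + <C x, C u>]. *)
Definition resolvent_map (Q : H -> H) := forall w, dom C (Q w) /\
  forall u, dom C u -> ip (Q w) u + ip (C (Q w)) (C u) = ip w u.

Lemma resolvent_exists : exists Q, resolvent_map Q.
Proof.
suff /choice[Q hQ] : forall w, exists x, dom C x /\
    forall u, dom C u -> ip x u + ip (C x) (C u) = ip w u by exists Q.
move=> w.
have [||| x [y [[dx ->] hxy]]] :=
    @projection R H (fun x y => dom C x /\ y = C x) w 0.
- by split; [exact: op_dom0 | rewrite op0].
- by move=> a x y x' y' [dx ->] [dx' ->]; rewrite opP //; split=> //; apply: op_domP.
- move=> u v x y h ux vy.
  have vE : v = C \o u by apply/funext => n; case: (h n).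
  have du n : dom C (u n) by case: (h n).
  rewrite vE in vy; by case: (closed_op_lim C_closed du ux vy) => dx <-.
exists x; split => // u du; have := hxy u (C u) (conj du erefl).
by rewrite sub0r ipNl ipBl; lra.
Qed.

Variables (Q : H -> H) (QP : resolvent_map Q).

Lemma resolvent_dom w : dom C (Q w). Proof. by case: (QP w). Qed.

Lemma resolventE w u : dom C u -> ip (Q w) u + ip (C (Q w)) (C u) = ip w u.
Proof. by case: (QP w) => _ h /h. Qed.

Lemma resolvent_energy w : ip (Q w) w = nm (Q w) ^+ 2 + nm (C (Q w)) ^+ 2.
Proof. by rewrite ipC -(resolventE w (resolvent_dom w)) !ip_nm. Qed.

Lemma resolvent_uniq x w : dom C x ->
  (forall u, dom C u -> ip x u + ip (C x) (C u) = ip w u) -> x = Q w.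
Proof.
move=> dx hx.
have dd := op_domB C_lin dx (resolvent_dom w).
have := hx _ dd; rewrite -(resolventE w dd) => e.
have : nm (x - Q w) ^+ 2 + nm (C (x - Q w)) ^+ 2 = 0.
  rewrite -!ip_nm [ip (x - Q w) _]ipBl {1}(opB C_lin dx (resolvent_dom w)) ipBl.
  lra.
have := sqr_ge0 (nm (x - Q w)); have := sqr_ge0 (nm (C (x - Q w))) => h1 h2 h.
apply/eqP; rewrite -subr_eq0; apply/eqP/nm_eq0/eqP; rewrite -sqrf_eq0.
by apply/eqP; lra.
Qed.

Lemma resolvent_linear : linear Q.
Proof.
move=> a w w'; have dw := resolvent_dom; apply/esym/resolvent_uniq => [|u du].
  exact: op_domP.
rewrite (opP C_lin) // !ipDl !ipJ -(opZ C_lin) //.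
have := resolventE w (op_domZ C_lin a^*%C du).
have := resolventE w' du; lra.
Qed.

Lemma resolvent_sym : symmetric_map Q.
Proof.
move=> w w'; rewrite [LHS]ipC -(resolventE w' (resolvent_dom w)).
by rewrite -(resolventE w (resolvent_dom w')) (ipC (Q w)) (ipC (C (Q w))).
Qed.

Lemma resolvent_sqr_le w : nm (Q w) ^+ 2 <= ip (Q w) w.
Proof. by rewrite resolvent_energy lerDl sqr_ge0. Qed.

Lemma resolvent_le w : nm (Q w) <= nm w.
Proof.
have [->|n0] := eqVneq (nm (Q w)) 0; first exact: nm_ge0.
have := le_trans (resolvent_sqr_le w) (cauchy_schwarz _ _).
by rewrite expr2 ler_pM2l // lt0r n0 nm_ge0.
Qed.

(** The vectors [(Q w, C (Q w))] are dense in the graph of [C]: a vector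
   [(x, C x)] orthogonal to all of them satisfies [<x, w> = 0] for every [w]. *)
Lemma resolvent_core x : dom C x -> exists w : nat -> H,
  (Q \o w) @ \oo --> x /\ (C \o Q \o w) @ \oo --> C x.
Proof.
move=> dx.
(* K is the closure of the set of all (Q w, C (Q w)) *)
pose K p q := forall e : R, 0 < e ->
  exists w, nm (p - Q w) <= e /\ nm (q - C (Q w)) <= e.
have QL := resolvent_linear; have dQ := resolvent_dom.
have Kseq p q : K p q -> exists w : nat -> H,
    (Q \o w) @ \oo --> p /\ (C \o Q \o w) @ \oo --> q.
  move=> Kpq.
  have /choice[w hw] : forall n, exists w, nm (p - Q w) <= n.+1%:R^-1 /\
      nm (q - C (Q w)) <= n.+1%:R^-1.
    by move=> n; apply: Kpq; rewrite invr_gt0.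
  by exists w; split; apply: harmonic_nm_cvg => n; rewrite nm_distC;
    case: (hw n).
have KQ w : K (Q w) (C (Q w)).
  by move=> e /ltW e0; exists w; rewrite !subrr nm0.
have [|||p [q [Kpq hpq]]] := @projection R H K x (C x).
- by have := KQ 0; rewrite (linear_map0 QL) (op0 C_lin).
- move=> a p q p' q' Kp Kp' e e0.
  have [na [na0 naZ]] : exists na : R, 0 < na /\
      forall z : H, nm (a *: z) <= na * nm z.
    exists (complex.Re `|a| + 1); have := normc_Re_ge0 a; split; first by lra.
    by move=> z; rewrite nm_scale ler_wpM2r ?nm_ge0 // lerDl.
  have [w [hp hq]] := Kp (e / 2 / na) (divr_gt0 (divr_gt0 e0 (ltr0n _ 2)) na0).
  have [w' [hp' hq']] := Kp' (e / 2) (divr_gt0 e0 (ltr0n _ 2)).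
  have bound z t z' t' : nm (z - t) <= e / 2 / na -> nm (z' - t') <= e / 2 ->
      nm (a *: z + z' - (a *: t + t')) <= e.
    move=> h h'; rewrite opprD addrACA -scalerBr.
    apply: le_trans (nmD _ _) _; have := naZ (z - t).
    have : na * nm (z - t) <= e / 2 by rewrite mulrC -ler_pdivlMr.
    lra.
  by exists (a *: w + w'); rewrite QL opP //; split; apply: bound.
- move=> u v p q Kuv up vq e e0.
  have e20 : 0 < e / 2 by rewrite divr_gt0.
  have /cvg_nmP/cvgrPdist_lt/(_ _ e20)[N1 _ hN1] := up.
  have /cvg_nmP/cvgrPdist_lt/(_ _ e20)[N2 _ hN2] := vq.
  pose n := maxn N1 N2.
  have [w [hp hq]] := Kuv n _ e20.
  have := hN1 n (leq_maxl _ _); have := hN2 n (leq_maxr _ _) => /=.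
  rewrite !sub0r !normrN !ger0_norm ?nm_ge0 // => h2 h1; exists w; split.
    have := nmB (u n - Q w) (u n - p).
    rewrite opprB addrC addrA subrK; lra.
  have := nmB (v n - C (Q w)) (v n - q).
  rewrite opprB addrC addrA subrK; lra.
have [w [Qw CQw]] := Kseq _ _ Kpq.
have [dp Cp] := closed_op_lim C_closed (fun n => dQ (w n)) Qw CQw.
suff <- : p = x by rewrite Cp; exact: Kseq.
have dxp := op_domB C_lin dx dp.
have h := hpq _ _ (KQ (x - p)); move: h.
rewrite -Cp -(opB C_lin) // ipC (ipC (C _)) resolventE // ip_nm => /eqP.
by rewrite sqrf_eq0 => /eqP/nm_eq0/eqP; rewrite subr_eq0 eq_sym => /eqP.
Qed.

Variables (N : H -> H) (N_lin : linear N) (N_sym : symmetric_map N).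
Hypotheses (N_pos : positive_map N) (NN : forall w, N (N w) = Q w - Q (Q w)).
Hypothesis QN : forall w, Q (N w) = N (Q w).

Lemma modulus_core_norm w : nm (N w) = nm (C (Q w)).
Proof.
apply/eqP; rewrite -(eqrXn2 (n := 2)) ?nm_ge0 //; apply/eqP.
rewrite -ip_nm -N_sym NN ipBl resolvent_energy resolvent_sym ip_nm; lra.
Qed.

(** The equality [Q = Q ^+ 2 + N ^+ 2] writes [N Q] as
   [Q N Q + N N N], a sum of two positive maps. *)
Lemma modulus_core_pos w : 0 <= inner (N w) (Q w).
Proof.
apply/inner_ge0P; split.
  have -> : Q w = Q (Q w) + N (N w) by rewrite NN addrC subrK.
  rewrite ipDr -resolvent_sym QN [X in _ + X]ipC.
  by rewrite addr_ge0 // N_pos.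
(* the imaginary part vanishes because the map Q N = N Q is symmetric *)
have NZ := linear_mapZ N_lin; have QZ := linear_mapZ resolvent_linear.
have conji : ('i^*)%C = (-1) * 'i%C :> R[i].
  by apply/eqP; rewrite eq_complex /=; apply/andP; split; apply/eqP; ring.
have : ip (N w) ('i%C *: Q w) = - ip (N w) ('i%C *: Q w).
  rewrite -{1}QZ -resolvent_sym QN N_sym NZ ipC ipJ conji -scalerA scaleN1r.
  by rewrite ipNr.
lra.
Qed.

(** The modulus is the closure of [Q w |-> N w]. *)
Definition modulus_rel x y := exists w : nat -> H,
  [/\ (Q \o w) @ \oo --> x, (C \o Q \o w) @ \oo --> C x &
      (N \o w) @ \oo --> y].

Lemma modulus_core_dist w w' : nm (N w - N w') = nm (C (Q w) - C (Q w')).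
Proof.
rewrite -(linear_mapB N_lin) modulus_core_norm (linear_mapB resolvent_linear).
by rewrite (opB C_lin) //; exact: resolvent_dom.
Qed.

Lemma modulus_rel_total x : dom C x -> exists y, modulus_rel x y.
Proof.
move=> /resolvent_core[w [Qw CQw]].
have [|y Ny] := cvg_dominated (u := N \o w) CQw; last by exists y, w.
by move=> m n; rewrite /= modulus_core_dist.
Qed.

Lemma modulus_rel_func x y y' : modulus_rel x y -> modulus_rel x y' -> y = y'.
Proof.
move=> [w [_ CQw Nw]] [w' [_ CQw' Nw']].
apply: cvg_lim_eq Nw _; apply: (@cvg_nm_le _ _ _ _
  (fun n => nm (C (Q (w n)) - C (Q (w' n))) + nm (N (w' n) - y'))).
  move=> n; rewrite -modulus_core_dist; apply: le_trans (nmD _ _).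
  by rewrite addrA subrK.
rewrite -[0]addr0; apply: cvgD; last exact/cvg_nmP.
have : ((C \o Q \o w) \- (C \o Q \o w')) @ \oo --> C x - C x by apply: cvgB.
by move/cvg_nm; rewrite subrr nm0.
Qed.

Lemma modulus_rel_linear a x y x' y' : dom C x -> dom C x' ->
  modulus_rel x y -> modulus_rel x' y' ->
  modulus_rel (a *: x + x') (a *: y + y').
Proof.
move=> dx dx' [w [Qw CQw Nw]] [w' [Qw' CQw' Nw']].
have dQ := resolvent_dom.
exists (fun n => a *: w n + w' n); split; rewrite ?(opP C_lin) //.
- rewrite (_ : Q \o _ = fun n => a *: (Q \o w) n + (Q \o w') n).
    by apply: cvgD => //; apply: cvgZr.
  by apply/funext => n /=; rewrite resolvent_linear.
- rewrite (_ : C \o Q \o _ =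
      fun n => a *: (C \o Q \o w) n + (C \o Q \o w') n).
    by apply: cvgD => //; apply: cvgZr.
  by apply/funext => n /=; rewrite resolvent_linear (opP C_lin).
- rewrite (_ : N \o _ = fun n => a *: (N \o w) n + (N \o w') n).
    by apply: cvgD => //; apply: cvgZr.
  by apply/funext => n /=; rewrite N_lin.
Qed.

Lemma modulus_rel_norm x y : modulus_rel x y -> nm y = nm (C x).
Proof.
move=> [w [_ CQw Nw]]; have := cvg_nm CQw.
rewrite (_ : (fun n => _) = fun n => nm ((N \o w) n)); last first.
  by apply/funext => n /=; rewrite modulus_core_norm.
by move=> h; apply: (cvg_unique _ (cvg_nm Nw) h).
Qed.

Lemma modulus_rel_pos x y : modulus_rel x y -> 0 <= inner y x.
Proof.
move=> [w [Qw _ Nw]]; apply/inner_ge0P; split.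
  apply: cvgr_to_ge (cvg_ip Nw Qw) _; near=> n.
  by case/inner_ge0P: (modulus_core_pos (w n)).
have h : (fun n => ip ((N \o w) n) ('i%C *: (Q \o w) n)) @ \oo -->
    ip y ('i%C *: x) by apply: cvg_ip => //; apply: cvgZr.
have h0 : (fun n => ip ((N \o w) n) ('i%C *: (Q \o w) n)) @ \oo --> (0 : R).
  rewrite (_ : (fun n => _) = fun=> 0); first exact: cvg_cst.
  by apply/funext => n; case/inner_ge0P: (modulus_core_pos (w n)).
exact: (cvg_unique _ h h0).
Unshelve. all: by end_near. Qed.

End Modulus.

(** For densely defined [C], the operator [|C|] arises as the closure of the map sending
   [(1 + C^* C)^-1 w] to [(C^* C)^(1/2) (1 + C^* C)^-1 w]. Working with the
   closure of this restriction avoids defining square roots of unbounded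
   operators. *)
Lemma modulus_exists (R : realType) (H : hilbertType R) (C : operator H) :
  linear_op C -> closed_op C -> exists S : operator H,
    [/\ dom S = dom C, linear_op S, positive_op S &
        forall x, dom C x -> nm (S x) = nm (C x)].
Proof.
move=> C_lin C_closed.
have [Q QP] := resolvent_exists C_lin C_closed.
have Q_lin := resolvent_linear C_lin QP.
have Q_sym := resolvent_sym QP.
pose X w := w - (Q w - Q (Q w)).
have QB := linear_mapB Q_lin.
have X_lin : linear X.
  move=> a x y; apply: ip_ext => z.
  by rewrite /X !Q_lin !scalerBr !(ipDl, ipBl, ipNl); ring.
have X_sym : symmetric_map X.
  by move=> x y; rewrite /X !(ipBl, ipBr) !Q_sym.
(* |w - b| ^+ 2 <= |w| ^+ 2 follows from |b| ^+ 2 <= <b, w> for b = Q (w - Q w) *)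
have X_le w : nm (X w) <= nm w.
  rewrite -(ler_pXn2r (n := 2)) ?nnegrE ?nm_ge0 // -[leLHS]ip_nm -[leRHS]ip_nm.
  have := resolvent_sqr_le QP (w - Q w); rewrite QB -ip_nm.
  have : ip (Q (Q w)) (Q w) <= ip (Q w) (Q w).
    apply: le_trans (cauchy_schwarz _ _) _.
    by rewrite ip_nm expr2 ler_wpM2r ?nm_ge0 // (resolvent_le QP).
  rewrite /X; set b := Q w - Q (Q w) => h1 h2.
  have : 0 <= ip b b by rewrite ip_nm sqr_ge0.
  have bQ : ip b (Q w) = ip (Q w) (Q w) - ip (Q (Q w)) (Q w) by rewrite /b ipBl.
  clearbody b; move: h1 h2; rewrite !(ipBl, ipBr) (ipC w b) bQ; lra.
have [N [N_lin N_sym N_pos NX NZ]] := sqrt_exists X_lin X_sym X_le.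
have NN w : N (N w) = Q w - Q (Q w) by rewrite NX /X opprB addrC subrK.
have QN w : Q (N w) = N (Q w).
  apply: (NZ Q 1) => // z; first by rewrite mul1r (resolvent_le QP).
  by rewrite /X !QB.
have /choice[S hS] : forall x, exists y, dom C x -> modulus_rel C Q N x y.
  move=> x; case: (pselect (dom C x)) => [dx|]; last by exists 0.
  have [y hy] := modulus_rel_total C_lin C_closed QP N_lin N_sym NN dx.
  by exists y.
have func := modulus_rel_func C_lin QP N_lin N_sym NN.
exists (Operator (dom C) S); split => //=.
- split; first exact: (op_dom0 C_lin).
  move=> a x y dx dy; have dxy := op_domP C_lin a dx dy; split=> //=.
  by apply: func (hS _ dxy) _; apply: modulus_rel_linear => //; exact: hS.
- by move=> x /= dx; apply: modulus_rel_pos (hS x dx).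
- by move=> x dx; apply: modulus_rel_norm (hS x dx).
Qed.

(** * Everywhere defined and bounded operators *)

Section Boundedness.
Context {R : realType} {H : hilbertType R}.
Implicit Types (x y z : H) (T A : operator H).

Lemma bounded_opP T : bounded_op T <->
  exists M : R, forall x, dom T x -> nm (T x) <= M * nm x.
Proof.
by split=> -[M h]; exists M => x dx; have := h x dx;
  rewrite !normE -rmorphM lecR.
Qed.

(** The gliding hump argument: if [f] were unbounded, one could sum a series of
   vectors of norm [3 ^ -n] whose limit [x] pairs with the vectors [f (y n)] so
   strongly that [f x] cannot have a finite norm. *)
Lemma symmetric_map_bounded (f : H -> H) : linear f -> symmetric_map f ->
  exists M : R, forall x, nm (f x) <= M * nm x.
Proof.
move=> f_lin f_sym; apply: contrapT => unb.
pose r n : R := 3^-1 ^+ n.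
have r0 n : 0 < r n by rewrite exprn_gt0 // invr_gt0.
have rS n : r n = 3 * r n.+1 by rewrite /r exprS mulrA divff // mul1r.
(* 3 ^ n compensates the size of the n-th term of the series, and n.+1 makes
   what remains unbounded *)
have /choice[y hy] : forall n, exists y, n.+1%:R * 3 ^+ n * nm y < nm (f y).
  move=> n; apply: contrapT => h; apply: unb.
  exists (n.+1%:R * 3 ^+ n) => x; rewrite leNgt; apply/negP => hx.
  by apply: h; exists x.
pose F n := nm (f (y n)).
have F0 n : 0 < F n.
  apply: le_lt_trans (hy n); rewrite !mulr_ge0 ?nm_ge0 //.
pose v n := ((F n)^-1)%:C *: f (y n).
have nmv n : nm (v n) = 1.
  by rewrite nmZ ger0_norm ?invr_ge0 ?nm_ge0 // mulVf // gt_eqF.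
have ipv n : ip (v n) (f (y n)) = F n.
  by rewrite ipZl ip_nm expr2 mulrA mulVf ?mul1r // gt_eqF.
pose step z n : H :=
  if 0 <= ip z (f (y n)) then z + (r n)%:C *: v n else z - (r n)%:C *: v n.
pose x := fix x n := if n is m.+1 then step (x m) m else 0.
have stepE z n : r n * F n <= `|ip (step z n) (f (y n))|.
  have := mulr_gt0 (r0 n) (F0 n); rewrite /step; case: ifP => h.
    rewrite ipDl ipZl ipv => ?; rewrite ger0_norm; lra.
  move/negbT: h; rewrite -ltNge ipBl ipZl ipv => ? ?; rewrite ltr0_norm; lra.
have step_dist z n : nm (step z n - z) <= r n.
  have hr : nm ((r n)%:C *: v n) = r n by rewrite nmZ nmv mulr1 ger0_norm ?ltW.
  by rewrite /step; case: ifP => _; rewrite addrAC subrr add0r ?nmN hr.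
(* the later terms add up to r n / 2, at most half of the n-th one *)
have dist n k : nm (x (n.+1 + k)%N - x n.+1) <= (r n - r (n + k)%N) / 2.
  elim: k => [|k IH]; first by rewrite !addn0 !subrr nm0 mul0r.
  rewrite !addnS.
  have := step_dist (x (n.+1 + k)%N) (n.+1 + k)%N.
  rewrite -[step _ _]/(x (n.+1 + k).+1) => hs.
  have := nmD (x (n.+1 + k).+1 - x (n.+1 + k)%N) (x (n.+1 + k)%N - x n.+1).
  rewrite addrA subrK; rewrite addSn in hs IH *.
  have := rS (n + k)%N; lra.
have dist_le n m : (n < m)%N -> nm (x m - x n.+1) <= r n / 2.
  by move=> /subnKC <-; apply: le_trans (dist _ _) _; have := r0 (n + (m - n.+1))%N; lra.
have r_cvg : r @ \oo --> (0 : R).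
  by apply: cvg_expr; rewrite ger0_norm ?invr_ge0 // invf_lt1 // ltr1n.
have [l xl] : exists l : H, x @ \oo --> l.
  apply: cvg_of_cauchy => e e0.
  have /cvgrPdist_lt/(_ _ e0)[N _ /(_ N (leqnn N))] := r_cvg.
  rewrite /= sub0r normrN gtr0_norm // => rN.
  exists N.+1 => m n Nm Nn.
  have := nmB (x m - x N.+1) (x n - x N.+1); rewrite opprB addrA subrK.
  have := dist_le _ _ Nm; have := dist_le _ _ Nn; lra.
have dl n : nm (l - x n.+1) <= r n / 2.
  have hc : (fun m => x m - x n.+1) @ \oo --> l - x n.+1.
    by apply: cvgB => //; apply: cvg_cst.
  apply: cvgr_to_le (cvg_nm hc) _; exists n.+1 => // m /= nm'.
  exact: dist_le.
have key n : n.+1%:R <= 2 * nm (f l).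
  have h1 : ip (f l) (y n) = ip (x n.+1) (f (y n)) + ip (l - x n.+1) (f (y n)).
    by rewrite -ipDl addrC subrK f_sym.
  have h2 := stepE (x n) n; rewrite -[step _ _]/(x n.+1) in h2.
  have h3 : `|ip (l - x n.+1) (f (y n))| <= r n / 2 * F n.
    by apply: le_trans (ip_norm_le _ _) _; rewrite ler_wpM2r ?nm_ge0.
  have h4 := ip_norm_le (f l) (y n).
  have h5 : r n / 2 * F n <= nm (f l) * nm (y n).
    apply: le_trans h4; rewrite h1.
    have := lerB_normD (ip (x n.+1) (f (y n))) (ip (l - x n.+1) (f (y n))).
    by move: (`|_ + _|) => w; lra.
  have r3 : r n * 3 ^+ n = 1 by rewrite -exprMn mulVf ?expr1n.
  have y0 : 0 < nm (y n).
    rewrite lt0r nm_ge0 andbT; apply/eqP => yn0.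
    by have := F0 n; rewrite /F (nm_eq0 yn0) (linear_map0 f_lin) nm0 ltxx.
  have h6 := ltW (hy n); rewrite -/(F n) in h6.
  have : n.+1%:R * nm (y n) <= 2 * nm (f l) * nm (y n).
    have := ler_wpM2l (ltW (r0 n)) h6.
    have -> : r n * (n.+1%:R * 3 ^+ n * nm (y n)) =
      n.+1%:R * nm (y n) * (r n * 3 ^+ n) by ring.
    rewrite r3 mulr1; move: (n.+1%:R * nm (y n)) => w; lra.
  by rewrite ler_pM2r.
have := key (Num.truncn (2 * nm (f l))).
by rewrite leNgt truncnS_gt.
Qed.

Lemma bounded_dom T : linear_op T -> densely_defined T -> closed_op T ->
  bounded_op T -> forall x, dom T x.
Proof.
move=> Tl Td Tc /bounded_opP[M hM] x.
have e0 n : (0 : R) < n.+1%:R^-1 by rewrite invr_gt0.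
have /choice[u hu] : forall n, exists u, dom T u /\ nm (u - x) <= n.+1%:R^-1.
  by move=> n; have [u du /ltW ux] := dense_approx x Td (e0 n); exists u.
have du n : dom T (u n) by case: (hu n).
have ux : u @ \oo --> x by apply: harmonic_nm_cvg => n; case: (hu n).
have Mux : (fun n => M%:C *: u n) @ \oo --> M%:C *: x by apply: cvgZr.
have [m n|y Ty] := cvg_dominated (u := T \o u) Mux.
  rewrite /= -scalerBr nmZ -(opB Tl) //.
  apply: le_trans (hM _ (op_domB Tl (du m) (du n))) _.
  by rewrite ler_wpM2r ?nm_ge0 // ler_norm.
by case: (closed_op_lim Tc du ux Ty).
Qed.

End Boundedness.

(** * Extending a closed operator by zero along a line *)

Section Extension.
Context {R : realType} {H : hilbertType R}.
Implicit Types (x y z : H) (a t : R[i]).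

Lemma line_closed (e : H) (t : nat -> R[i]) z :
  (fun n => t n *: e) @ \oo --> z -> exists s, z = s *: e.
Proof.
have [->|e0] := eqVneq e 0.
  move=> h; exists 0; rewrite scaler0; apply: cvg_lim_eq h _.
  by under eq_fun do rewrite scaler0; apply: cvg_cst.
move=> tz.
have c0 : inner e e != 0.
  by rewrite inner_norm sqrf_eq0 normr_eq0.
pose c x := inner x e / inner e e.
exists (c z); apply/eqP; rewrite -subr_eq0; apply/eqP.
(* [x - c x *: e] is orthogonal to [e], hence the shortest vector of the line
   through [x] directed by [e] *)
have contr x t0 : nm (x - c x *: e) <= nm (x - t0 *: e).
  have orth s : ip (x - c x *: e) (s *: e) = 0.
    by rewrite /ip innerZr innerDl innerNl innerZl divfK // subrr mulr0.
  have -> : x - t0 *: e = (x - c x *: e) + (c x - t0) *: e.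
    by rewrite scalerBl addrA subrK.
  have := orth (c x - t0); move: (x - _) (_ *: e) => p q pq.
  rewrite -(ler_pXn2r (n := 2)) ?nnegrE ?nm_ge0 // -!ip_nm ipDl !ipDr (ipC q p).
  by rewrite pq add0r addr0 lerDl ip_nm sqr_ge0.
apply/nm_eq0/eqP; rewrite eq_le nm_ge0 andbT.
have /cvg_nmP h := tz.
apply: cvgr_to_ge h _; near=> n; rewrite nm_distC; exact: contr.
Unshelve. all: by end_near. Qed.

Variables (A : operator H) (A_lin : linear_op A) (A_closed : closed_op A).
Variables (e : H) (e_dom : ~ dom A e).

(** Since [(e, 0)] is not in the closed graph of [A], it has a positive distance
   to it. *)
Lemma graph_gap : exists2 d : R, 0 < d &
  forall x, dom A x -> d <= nm (x - e) + nm (A x).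
Proof.
apply: contrapT => h.
have /choice[u hu] : forall n, exists x,
    dom A x /\ nm (x - e) + nm (A x) <= n.+1%:R^-1.
  move=> n; apply: contrapT => hn; apply: h; exists n.+1%:R^-1.
    by rewrite invr_gt0.
  move=> x dx; rewrite leNgt; apply/negP => /ltW hx.
  by apply: hn; exists x.
have du n : dom A (u n) by case: (hu n).
have ue : u @ \oo --> e.
  apply: harmonic_nm_cvg => n; case: (hu n) => _; apply: le_trans.
  by rewrite lerDl nm_ge0.
have Au : (A \o u) @ \oo --> 0.
  apply: harmonic_nm_cvg => n; case: (hu n) => _; apply: le_trans.
  by rewrite subr0 lerDr nm_ge0.
by case: (closed_op_lim A_closed du ue Au).
Qed.

Lemma dom_line_inj t : dom A (t *: e) -> t = 0.
Proof.
move=> h; apply/eqP; apply: contraT => t0; case: e_dom.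
by rewrite -[e]scale1r -(mulVf t0) -scalerA; apply: op_domZ.
Qed.

(** The sum of a closed subspace and a line is closed, whence the graph of the
   extension by zero is closed. *)
Lemma extension_by_zero : exists C : operator H,
  [/\ linear_op C, closed_op C,
      (forall x, dom A x -> dom C x /\ C x = A x) & dom C e /\ C e = 0].
Proof.
pose D y := exists t, dom A (y - t *: e).
have /choice[tau htau] : forall y, exists t, D y -> dom A (y - t *: e).
  move=> y; case: (pselect (D y)) => [[t ht]|h]; first by exists t.
  by exists 0.
have tauP y t : dom A (y - t *: e) -> tau y = t.
  move=> h; have hD : D y by exists t.
  have := op_domB A_lin h (htau y hD).
  rewrite opprB addrC addrA subrK -scalerBl => /dom_line_inj/eqP.
  by rewrite subr_eq0 => /eqP.
pose C := Operator D (fun y => A (y - tau y *: e)).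
have CE y t : dom A (y - t *: e) -> dom C y /\ C y = A (y - t *: e).
  by move=> h; split; [exists t | rewrite /C /= (tauP _ _ h)].
have C_lin : linear_op C.
  split; first by exists 0; rewrite scale0r subrr; exact: op_dom0.
  move=> a x y dx dy.
  have := htau x dx; have := htau y dy => hy hx.
  have E : a *: x + y - (a * tau x + tau y) *: e =
      a *: (x - tau x *: e) + (y - tau y *: e).
    by rewrite scalerBr scalerDl scalerA opprD addrACA.
  have [|dC ->] := CE (a *: x + y) (a * tau x + tau y).
    by rewrite E; apply: op_domP.
  by split=> //; rewrite E opP.
exists C; split => //.
- have [d d0 gap] := graph_gap.
  have tau_le y : D y -> d * nm (tau y *: e) <= (nm y + nm (C y)) * nm e.
    move=> dy; have [->|t0] := eqVneq (tau y) 0.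
      by rewrite scale0r nm0 mulr0 mulr_ge0 ?addr_ge0 ?nm_ge0.
    have dy' := htau y dy.
    have := gap _ (op_domZ A_lin (- (tau y)^-1) dy').
    rewrite (opZ A_lin) //.
    have -> : - (tau y)^-1 *: (y - tau y *: e) - e = - (tau y)^-1 *: y.
      by rewrite scalerBr !scaleNr opprK scalerA mulVf // scale1r addrK.
    move=> /(ler_wpM2l (normc_Re_ge0 (tau y))).
    rewrite mulrDr -!nm_scale !scalerA mulrN divff //.
    rewrite !scaleN1r !nmN nm_scale => h.
    by rewrite mulrA [d * _]mulrC ler_wpM2r ?nm_ge0.
  apply: closed_op_of_lim => u x y du ux Cuy.
  have tau_dist m n : d * nm (tau (u m) *: e - tau (u n) *: e) <=
      (nm (u m - u n) + nm (C (u m) - C (u n))) * nm e.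
    have := tau_le _ (op_domB C_lin (du m) (du n)).
    rewrite -(opB C_lin) // -scalerBl (_ : tau (u m - u n) = tau (u m) - tau (u n)) //.
    apply: tauP.
    have -> : u m - u n - (tau (u m) - tau (u n)) *: e =
        (u m - tau (u m) *: e) - (u n - tau (u n) *: e).
      rewrite scalerBl !opprB addrACA [RHS]addrACA; congr (_ + _).
      by rewrite addrC.
    by apply: (op_domB A_lin); apply: htau; apply: du.
  have [z tz] : exists z : H, (fun n => tau (u n) *: e) @ \oo --> z.
    apply: cvg_of_cauchy => eps eps0.
    have ne0 : 0 < nm e + 1 by rewrite ltr_wpDl ?nm_ge0.
    have eps1 : 0 < eps * d / (nm e + 1) / 2 by rewrite !divr_gt0 // mulr_gt0.
    have [N1 h1] := cvg_cauchy_nm ux eps1.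
    have [N2 h2] := cvg_cauchy_nm Cuy eps1.
    exists (maxn N1 N2) => m n; rewrite !geq_max => /andP[m1 m2] /andP[n1 n2].
    have := tau_dist m n; have := h1 _ _ m1 n1; have := h2 _ _ m2 n2.
    rewrite /= => b2 b1 b0.
    have b3 : nm (u m - u n) + nm (C (u m) - C (u n)) < eps * d / (nm e + 1).
      lra.
    rewrite -(ltr_pM2l d0) (mulrC d eps); apply: le_lt_trans b0 _.
    apply: le_lt_trans (_ : _ * (nm e + 1) < _).
      by apply: ler_wpM2l; rewrite ?addr_ge0 ?nm_ge0 // lerDl.
    by rewrite -ltr_pdivlMr.
  have [s zE] := line_closed tz.
  have duA n : dom A (u n - tau (u n) *: e) by apply: htau; apply: du.
  have lim1 : (fun n => u n - tau (u n) *: e) @ \oo --> x - s *: e.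
    by rewrite -zE; apply: cvgB.
  have [dA AE] := closed_op_lim A_closed duA lim1 Cuy.
  by have [? ->] := CE _ _ dA.
- by move=> x dx; have := CE x 0; rewrite scale0r subr0; apply.
- have := CE e 1; rewrite scale1r subrr (op0 A_lin); apply; exact: op_dom0.
Qed.

End Extension.

(** * Operators with a given absolute value *)

Section AbsoluteValue.
Context {R : realType} {H : hilbertType R}.
Implicit Types (x y z : H) (T A : operator H).

Lemma positive_op_inner T : linear_op T -> positive_op T ->
  forall x y, dom T x -> dom T y -> inner (T x) y = inner x (T y).
Proof.
move=> Tl Tp x y dx dy; apply: inner_eq => a.
by rewrite -(opZ Tl) // (positive_op_sym Tl Tp) //; exact: op_domZ.
Qed.

Lemma adjoint_val_uniq T y z z' : densely_defined T ->
  adjoint_val T y z -> adjoint_val T y z' -> z = z'.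
Proof.
move=> Td hz hz'; apply/eqP; rewrite -subr_eq0; apply/eqP.
have orth x : dom T x -> ip x (z - z') = 0.
  by move=> dx; rewrite ipBr /ip -hz // -hz' // subrr.
apply/nm_eq0/eqP; rewrite eq_le nm_ge0 andbT.
apply/ler_addgt0Pl => e e0; rewrite addr0.
have [x dx xe] := dense_approx (z - z') Td e0.
have := nm_ge0 (z - z'); rewrite le_eqVlt => /orP[/eqP <-|n0]; first exact: ltW.
rewrite -(ler_pM2r n0) -expr2 -ip_nm.
have -> : ip (z - z') (z - z') = ip (z - z' - x) (z - z').
  by rewrite [RHS]ipBl (orth x dx) subr0.
apply: le_trans (cauchy_schwarz _ _) _.
by rewrite ler_pM2r // nm_distC ltW.
Qed.

Lemma adjointE T y z : densely_defined T -> adjoint_val T y z ->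
  adjoint T y = z.
Proof.
move=> Td hz; apply: (@adjoint_val_uniq T y) => //.
by rewrite /adjoint /=; case: xgetP => [w -> //|/(_ z)].
Qed.

Lemma selfadjoint_closed A : selfadjoint A -> closed_op A.
Proof.
move=> [Ad [domE valE]]; apply: closed_op_of_lim => u x y du ux Auy.
have lim v w : (forall n, ip v (A (u n)) = ip w (u n)) -> ip v y = ip w x.
  move=> h.
  have h1 : (fun n => ip v ((A \o u) n)) @ \oo --> ip v y.
    by apply: cvg_ip => //; apply: cvg_cst.
  have h2 : (fun n => ip w (u n)) @ \oo --> ip w x.
    by apply: cvg_ip => //; apply: cvg_cst.
  rewrite (_ : (fun n => ip w _) = (fun n => ip v ((A \o u) n))) in h2.
    exact: (cvg_unique _ h1 h2).
  by apply/funext => n /=; rewrite h.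
have adj n v : dom A v -> inner (A v) (u n) = inner v (A (u n)).
  move=> dv; have := du n; rewrite domE => -[z hz].
  by rewrite (valE _ (du n)) (adjointE Ad hz) hz.
have hxy : adjoint_val A x y.
  move=> v dv; apply: inner_eq => a; apply/esym/lim => n.
  by rewrite !ipJ /ip !innerZr adj.
have dx : dom A x by rewrite domE; exists y.
by split=> //; rewrite (valE _ dx) (adjointE Ad hxy).
Qed.

(** [T^* T] depends only on the form [<T u, T x>], hence, by polarization, only
   on the norms [|T x|]. *)
Lemma is_abs_of_norm A T : linear_op A -> selfadjoint A -> positive_op A ->
  linear_op T -> dom T = dom A -> (forall x, dom A x -> nm (T x) = nm (A x)) ->
  is_abs T A.
Proof.
move=> Al As Ap Tl TA nmE; split => //.
have ipE u x : dom A u -> dom A x -> ip (T u) (T x) = ip (A u) (A x).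
  move=> du dx.
  have polar (v w : H) : ip v w = (nm (v + w) ^+ 2 - nm v ^+ 2 - nm w ^+ 2) / 2.
    by rewrite -!ip_nm ipDl !ipDr (ipC w v); lra.
  rewrite !polar -(opD Al) // -(opD Tl) ?TA // !nmE //.
  exact: op_domD.
have innE u x : dom A u -> dom A x -> inner (T u) (T x) = inner (A u) (A x).
  move=> du dx; apply: inner_eq => a.
  by rewrite -(opZ Tl) ?TA // -(opZ Al) // ipE //; exact: op_domZ.
have adjE x : dom A x -> adjoint_val T (T x) = adjoint_val A (A x).
  move=> dx; apply/seteqP; split=> z hz u /=; rewrite ?TA => du.
    by rewrite -innE // hz // TA.
  by rewrite innE // hz.
have [_ [domE valE]] := As.
have adj_dom x : dom A x -> dom (adjoint T) (T x) = dom A (A x).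
  move=> dx; rewrite domE.
  by rewrite -[LHS]/(adjoint_val T (T x) !=set0) adjE.
split.
  apply/seteqP; split=> x [dx h]; rewrite ?TA in dx *.
    by split; rewrite ?TA ?adj_dom.
  by split=> //; rewrite -adj_dom.
move=> x [dx dAx] /=; rewrite [LHS]valE //=.
by rewrite adjE.
Qed.

Lemma positive_closed_self A : linear_op A -> selfadjoint A -> positive_op A ->
  positive_closed_with_abs A A.
Proof.
move=> Al As Ap; split => //; first by case: As.
  exact: selfadjoint_closed.
exact: is_abs_of_norm.
Qed.

Lemma abs_uniq_of_bounded A T : linear_op A -> selfadjoint A -> positive_op A ->
  bounded_op A -> positive_closed_with_abs A T -> op_eq T A.
Proof.
move=> Al As Ap Ab [Tl Td Tc Tp [_ _ _ [domE valE]]].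
have [Ad _] := As.
have dA := bounded_dom Al Ad (selfadjoint_closed As) Ab.
have dAA x : dom (comp_op A A) x by split; exact: dA.
have dT x : dom T x by have := dAA x; rewrite domE => -[].
have TT x : T (T x) = A (A x).
  have := valE x (dAA x); rewrite /= => ->; apply/esym/adjointE => // u du.
  by rewrite (positive_op_inner Tl Tp).
split; first by apply/seteqP; split=> x _; [exact: dA | exact: dT].
move=> x _; have /bounded_opP[M hM] := Ab.
pose c := `|M| + 1.
have c0 : 0 < c by rewrite ltr_wpDl.
have lin (S : operator H) : linear_op S -> (forall x, dom S x) -> linear S.
  by move=> Sl dS a u v; rewrite (opP Sl).
have pos (S : operator H) : positive_op S -> (forall x, dom S x) -> positive_map S.
  by move=> Sp dS u; case/inner_ge0P: (Sp u (dS u)).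
apply/esym; apply: (positive_sqrt_unique c0) => //.
- move=> u; apply: le_trans (hM u (dA u)) _; rewrite ler_wpM2r ?nm_ge0 //.
  by have := ler_norm M; rewrite /c; lra.
- exact: lin.
- exact: lin.
- by move=> u v; apply: positive_op_sym.
- by move=> u v; apply: positive_op_sym.
- exact: pos.
- exact: pos.
Qed.

(** Let [e] lie outside the domain of [A], and let [C] extend [A] by [C e = 0].
   The restriction [T] of [|C|] to the domain of [A] is positive and satisfies
   [|T x| = |A x|]. It is not [A]: its symmetric extension [|C|] vanishes at
   [e], so [<T x, e> = 0] for all [x], whereas [e] is not in the domain of
   [A^*]. *)
Lemma abs_not_uniq A e : linear_op A -> selfadjoint A -> positive_op A ->
  ~ dom A e -> exists2 T, positive_closed_with_abs A T & ~ op_eq T A.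
Proof.
move=> Al As Ap de; have Ac := selfadjoint_closed As.
have [C [Cl Cc CA [dCe Ce]]] := extension_by_zero Al Ac de.
have [S [domS Sl Sp nmS]] := modulus_exists Cl Cc.
have dS x : dom A x -> dom S x by rewrite domS => /CA[].
have nmSA x : dom A x -> nm (S x) = nm (A x).
  by move=> /CA[dx CE]; rewrite nmS // CE.
pose T := Operator (dom A) S.
have Tl : linear_op T.
  split; first exact: (op_dom0 Al).
  move=> a x y dx dy; split; first exact: (op_domP Al).
  by apply: (opP Sl); apply: dS.
exists T.
  split => //; first by case: As.
  - apply: closed_op_of_lim => u x y du ux Tuy.
    have dist v w : dom A v -> dom A w -> nm (A v - A w) = nm (S v - S w).
      by move=> dv dw; rewrite -(opB Al) // -(opB Sl) ?nmSA //;
        [exact: (op_domB Al) | exact: dS | exact: dS].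
    have [m n|z Auz] := cvg_dominated (u := A \o u) Tuy; first by rewrite /= (dist _ _ (du m) (du n)).
    have [dx Ax] := closed_op_lim Ac du ux Auz.
    split=> //; apply: cvg_lim_eq Tuy.
    apply/cvg_nmP; rewrite (_ : (fun n => _) = fun n => nm ((A \o u) n - z)).
      exact/cvg_nmP.
    by apply/funext => n /=; rewrite -Ax (dist _ _ (du n) dx).
  - by move=> x dx; apply: Sp; apply: dS.
  - exact: is_abs_of_norm.
move=> [_ TA]; apply: de; have [_ [-> _]] := As.
have dSe : dom S e by rewrite domS.
have Se : S e = 0 by apply: nm_eq0; rewrite nmS // Ce nm0.
exists 0 => x dx; rewrite -TA //= (positive_op_inner Sl Sp) ?Se //.
exact: dS.
Qed.

End AbsoluteValue.

Theorem theorem4p1 (R : realType) (H : hilbertType R) (A : operator H)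
    (A_linear : linear_op A) (A_selfadjoint : selfadjoint A)
    (A_positive : positive_op A) :
  (positive_closed_with_abs A A /\
   forall T : operator H, positive_closed_with_abs A T -> op_eq T A)
  <-> bounded_op A.
Proof.
split=> [[_ uniq]|A_bounded]; last first.
  split; first exact: positive_closed_self.
  by move=> T; apply: abs_uniq_of_bounded.
have domA x : dom A x.
  apply: contrapT => /(abs_not_uniq A_linear A_selfadjoint A_positive)[T hT].
  by apply; exact: uniq.
apply/bounded_opP; have [M hM] : exists M : R, forall x, nm (A x) <= M * nm x.
  apply: symmetric_map_bounded.
    by move=> a x y; rewrite (opP A_linear).
  by move=> x y; apply: positive_op_sym.
by exists M => x _.
Qed.
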